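(* Let $0<\beta<1$, let $T\ge 2$ be an integer, let $K_{TC2}$ be the $T\times T$ TC2 kernel matrix with hyperparameter $\beta$, and let $L$ denote the Cholesky factor of $K_{TC2}^{-1}$ (so $L$ is lower triangular with positive diagonal and $K_{TC2}^{-1}=LL^\top$). Then $$[L]_{t,s}=\begin{cases}\dfrac{1}{\sqrt{(1-\beta)^3\beta^t}}, & 1\le t=s\le T-2,\\[2mm] \dfrac{-2}{\sqrt{(1-\beta)^3\beta^{t-1}}}, & 2\le t=s+1\le T-1,\\[2mm] \dfrac{1}{\sqrt{(1-\beta)^3\beta^{t-2}}}, & 3\le t=s+2\le T,\\[2mm] \dfrac{\sqrt{\beta^{-T+1}(1+\beta)}}{1-\beta}, & t=s=T-1,\\[2mm] \dfrac{-2\sqrt{\beta^{-T+1}}}{(1-\beta)\sqrt{1+\beta}}, & t=s+1=T,\\[2mm] \sqrt{\dfrac{\beta^{-T}}{1+\beta}}, & t=s=T,\\[2mm] 0, & \text{otherwise.}\end{cases}$$ Moreover, $$\det K_{TC2}=\beta^{\frac{T(T+1)}{2}}(1-\beta)^{3T-4}.$$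
   Context: Let $0<\beta<1$. Let $\mathcal{F}$ be the infinite (indexed by $t,s\ge 1$) lower triangular Toeplitz matrix with first column $(1,-1,0,0,\ldots)^\top$ and $\mathcal{D}=\mathrm{diag}(\beta^{-1},\beta^{-2},\ldots,\beta^{-t},\ldots)$. The (infinite) TC2 kernel is $\mathcal{K}_{TC2}=(1-\beta)^3(\mathcal{F}^2\mathcal{D}(\mathcal{F}^\top)^2)^{-1}$, where the inverse is understood as $(\mathcal{F}^{-2})^\top\mathcal{D}^{-1}\mathcal{F}^{-2}$, with $\mathcal{F}^{-1}$ the lower triangular Toeplitz inverse of $\mathcal{F}$, and entries of products of infinite matrices are (convergent) series. The $T\times T$ kernel matrix $K_{TC2}$ is defined by $[K_{TC2}]_{t,s}=[\mathcal{K}_{TC2}]_{t,s}$ for $t,s=1,\ldots,T$. *)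

(* Defs.v *)
From HB Require Import structures.
From mathcomp Require Import all_boot all_order all_algebra.
From mathcomp Require Import all_classical all_reals all_analysis.
Import Order.TTheory GRing.Theory Num.Theory.
Import numFieldNormedType.Exports.

Set Implicit Arguments.
Unset Strict Implicit.
Unset Printing Implicit Defensive.

Local Open Scope ring_scope.
Local Open Scope classical_set_scope.

(* Rows and columns are numbered from 0: A i j is the entry usually written   *)
(* [A]_{i+1,j+1}.                                                             *)
Definition infmx (R : Type) : Type := nat -> nat -> R.

Section InfiniteMatrices.
Variable R : realType.
Implicit Types A B : nat -> nat -> R.

Definition inf_diag (d : nat -> R) : infmx R :=
  fun i j => if i == j then d i else 0.

Definition inf_id : infmx R := inf_diag (fun=> 1).

Definition inf_tr A : infmx R := fun i j => A j i.

Definition inf_scale (a : R) A : infmx R := fun i j => a * A i j.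

Definition inf_mul A B : infmx R :=
  fun i j => limn (series (fun k => A i k * B k j)).

Definition inf_toeplitz (c : nat -> R) : infmx R :=
  fun i j => if (j <= i)%N then c (i - j)%N else 0.

Definition is_lower_toeplitz A : Prop := exists c, A = inf_toeplitz c.

Definition is_lower_toeplitz_inverse A B : Prop :=
  [/\ is_lower_toeplitz B, inf_mul A B = inf_id & inf_mul B A = inf_id].

(* Unique when it exists, since products of lower triangular infinite         *)
(* matrices are finite sums; inf_id is a dummy value otherwise.               *)
Definition lower_toeplitz_inv A : infmx R :=
  xget (inf_id : nat -> nat -> R) [set B | is_lower_toeplitz_inverse A B].

Definition TC2_F : infmx R :=
  inf_toeplitz (fun k => if k == 0%N then 1 else if k == 1%N then -1 else 0).

Definition TC2_D (beta : R) : infmx R := inf_diag (fun i => beta ^- i.+1).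

Definition TC2_Dinv (beta : R) : infmx R :=
  inf_diag (fun i => (TC2_D beta i i)^-1).

Definition TC2_Finv2 : infmx R :=
  inf_mul (lower_toeplitz_inv TC2_F) (lower_toeplitz_inv TC2_F).

Definition TC2_kernel (beta : R) : infmx R :=
  inf_scale ((1 - beta) ^+ 3)
    (inf_mul (inf_mul (inf_tr TC2_Finv2) (TC2_Dinv beta)) TC2_Finv2).

Definition K_TC2 (beta : R) (T : nat) : 'M[R]_T :=
  \matrix_(i < T, j < T) TC2_kernel beta i j.

Definition is_cholesky_factor (n : nat) (A L : 'M[R]_n) : Prop :=
  [/\ is_trig_mx L, forall i, 0 < L i i & A = L *m L^T].

End InfiniteMatrices.

(* Main.v *)
(* The inverse of F is the lower triangular matrix of ones, so the entry of the
   TC2 kernel at (i, i + d), numbered from 0, is (1 - beta)^3 times the series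
   of (k + 1 - i) (k + 1 - i - d) beta^(k + 1), which telescopes to
     beta^(i + d + 1) (1 + beta + d (1 - beta)).
   Up to and including the first superdiagonal, row i of K is affine in the
   column index, so second differences of columns vanish below the diagonal.
   Hence K L is upper triangular for the banded L of the theorem, whose last
   two columns are a boundary correction.  Then L^T K L is both symmetric and
   upper triangular with unit diagonal, so it is the identity: K^-1 = L L^T and
   det K = (det L)^-2.  Uniqueness of Cholesky factors concludes. *)
Require Import Defs.
From mathcomp Require Import all_boot all_order all_algebra.
From mathcomp Require Import all_classical all_reals all_analysis.
From mathcomp Require Import zify ring lra.
Import Order.TTheory GRing.Theory Num.Theory.
Import numFieldNormedType.Exports.
Local Open Scope ring_scope.

(** * Decay of [n x^n] and [n^2 x^n] for [0 < x < 1] *)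

Section GeometricMoments.
Context {R : realType}.
Implicit Types x : R.

(** Each of the [n] terms of [1 + x + ... + x^(n-1)] is at least [x^n], and [1 - x] times this sum
    is [1 - x^n]. *)
Lemma natmul_expr_le x n : 0 <= x -> x <= 1 ->
  n%:R * x ^+ n * (1 - x) <= 1 - x ^+ n.
Proof.
move=> x0 x1; elim: n => [|n IHn]; first by rewrite expr0; lra.
have xn0 : 0 <= x ^+ n.+1 by rewrite exprn_ge0.
have xn1 : x ^+ n.+1 <= 1 by rewrite exprn_ile1.
have {}IHn := ler_wpM2l x0 IHn.
rewrite -natr1; move: IHn xn0 xn1; rewrite exprS; set y := x ^+ n => *.
nra.
Qed.

(* With y = sqrt x, n x^n = (n y^n) y^n and the first factor is bounded. *)
Lemma cvg_natmul_expr x : 0 < x -> x < 1 ->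
  (n%:R * x ^+ n @[n --> \oo] --> (0 : R))%classic.
Proof.
move=> x0 x1; set y := Num.sqrt x.
have y0 : 0 < y by rewrite sqrtr_gt0.
have y2 : y ^+ 2 = x by rewrite sqr_sqrtr // ltW.
have y1 : y < 1 by rewrite -(ltr_pXn2r (n := 2)) ?nnegrE ?ltW // expr1n y2.
have y1' : 0 < 1 - y by rewrite subr_gt0.
apply: (@squeeze_cvgr _ _ _ _ (fun=> 0) (geometric (1 - y)^-1 y)).
- apply: nearW => n; rewrite mulr_ge0 ?ler0n ?exprn_ge0 ?(ltW x0) //=.
  rewrite -y2 -exprM mul2n -addnn exprD mulrA.
  rewrite ler_wpM2r ?exprn_ge0 ?(ltW y0) //.
  rewrite -[leRHS]mul1r ler_pdivlMr //.
  have := natmul_expr_le y n (ltW y0) (ltW y1).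
  have : 0 <= y ^+ n by rewrite exprn_ge0 ?(ltW y0).
  lra.
- exact: cvg_cst.
- by apply: cvg_geometric; rewrite ger0_norm ?(ltW y0).
Qed.

(** With [y = sqrt x], the sequence is the square of [n y^n]. *)
Lemma cvg_natmul2_expr x : 0 < x -> x < 1 ->
  (n%:R ^+ 2 * x ^+ n @[n --> \oo] --> (0 : R))%classic.
Proof.
move=> x0 x1; set y := Num.sqrt x.
have y0 : 0 < y by rewrite sqrtr_gt0.
have y2 : y ^+ 2 = x by rewrite sqr_sqrtr // ltW.
have y1 : y < 1 by rewrite -(ltr_pXn2r (n := 2)) ?nnegrE ?ltW // expr1n y2.
have -> : (fun n => n%:R ^+ 2 * x ^+ n) =
          (fun n => (n%:R * y ^+ n) * (n%:R * y ^+ n)).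
  by apply/funext => n; rewrite -y2 exprAC; ring.
have /(_ y y0 y1) H := cvg_natmul_expr.
by rewrite -[0 in X in _ X](mulr0 0); apply: cvgM.
Qed.

End GeometricMoments.

(** * The inverse of [F] and the closed form of the kernel *)

Section Kernel.
Context {R : realType}.
Implicit Types (A B : infmx R) (beta : R).

(** The partial sums are constant from [N] on, so products of triangular matrices become finite
    sums. *)
Lemma inf_mul_finite A B N i j :
  (forall k, (N <= k)%N -> A i k * B k j = 0) ->
  inf_mul A B i j = \sum_(k < N) A i k * B k j.
Proof.
move=> AB0; apply: cvg_lim => //; apply: cvg_near_cst.
exists N => // n /= leNn.
rewrite /series /= (big_cat_nat (n := N)) //= [X in _ + X]big_nat_cond.
rewrite [X in _ + X]big1 => [|k].
  by rewrite addr0 big_mkord.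
by rewrite andbT => /andP[/AB0].
Qed.

Definition inf_cumsum : infmx R := inf_toeplitz (fun=> 1).

Lemma TC2_FE i j : TC2_F R i j = (i == j)%:R - (i == j.+1)%:R.
Proof.
rewrite /TC2_F /inf_toeplitz.
by do ![case: ifP => /=]; do ![case: eqP => /=]; try lia; rewrite ?subr0 ?sub0r ?subrr.
Qed.

(** Column [j] holds 1 in row [j] and -1 in row [j + 1]; a partial sum is nonzero only if it stops
    between them. *)
Lemma sum_TC2_F_col N j : \sum_(k < N) TC2_F R k j = (N == j.+1)%:R.
Proof.
elim: N => [|N IHN]; first by rewrite big_ord0.
by rewrite big_ord_recr /= IHN TC2_FE addrC subrK eqSS.
Qed.

Lemma TC2_F_cumsum : inf_mul (TC2_F R) inf_cumsum = inf_id R.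
Proof.
apply/funext => i; apply/funext => j.
rewrite (@inf_mul_finite _ _ i.+1) => [|k ik]; last first.
  by rewrite /TC2_F /inf_toeplitz leqNgt ik mul0r.
rewrite big_ord_recr /= /inf_id /inf_diag TC2_FE eqxx.
case: i => [|i].
  by rewrite big_ord0 add0r subr0 mul1r /inf_cumsum /inf_toeplitz leqn0 eq_sym.
(* Row [i + 1] of [F] is nonzero only in columns [i] and [i + 1]. *)
rewrite big_ord_recr /= big1 => [|k _]; last first.
  rewrite TC2_FE; have := ltn_ord k => ki.
  by rewrite !(gtn_eqF _) ?subrr ?mul0r // ?eqSS; lia.
rewrite TC2_FE eqxx /inf_cumsum /inf_toeplitz.
do ![case: ifP => /=]; do ![case: eqP => /=]; try lia; lra.
Qed.

Lemma cumsum_TC2_F : inf_mul inf_cumsum (TC2_F R) = inf_id R.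
Proof.
apply/funext => i; apply/funext => j.
rewrite (@inf_mul_finite _ _ i.+1) => [|k ik]; last first.
  by rewrite /inf_cumsum /inf_toeplitz leqNgt ik mul0r.
rewrite (eq_bigr (fun k : 'I_i.+1 => TC2_F R k j)) => [|k _]; last first.
  by rewrite /inf_cumsum /inf_toeplitz -ltnS ltn_ord mul1r.
by rewrite sum_TC2_F_col eqSS /inf_id /inf_diag; case: eqP.
Qed.

(* Column 0 of [F * B = 1] reads b_0 = 1 and b_(i+1) - b_i = 0. *)
Lemma TC2_FinvE : lower_toeplitz_inv (TC2_F R) = inf_cumsum.
Proof.
(* [lower_toeplitz_inv] is a choice, so [inf_cumsum] has to be an inverse and the only Toeplitz
   one. *)
apply: xget_unique.
  by split; [exists (fun=> 1) | exact: TC2_F_cumsum | exact: cumsum_TC2_F].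
move=> _ [[b ->] Fb _].
suff b1 : b = fun=> 1 by rewrite b1.
have Fbi i : (inf_mul (TC2_F R) (inf_toeplitz b)) i 0%N = (i == 0%N)%:R.
  by rewrite Fb /inf_id /inf_diag; case: eqP.
have bi i : \sum_(k < i.+1) TC2_F R i k * b k = (i == 0%N)%:R.
  rewrite -Fbi (@inf_mul_finite _ _ i.+1) => [|k ik]; last first.
    by rewrite /TC2_F /inf_toeplitz leqNgt ik mul0r.
  by apply: eq_bigr => k _; rewrite [in RHS]/inf_toeplitz leq0n subn0.
apply/funext; elim=> [|i IHi].
  by have := bi 0%N; rewrite big_ord_recr big_ord0 /= TC2_FE eqxx /=; lra.
have := bi i.+1; rewrite !big_ord_recr /= big1 => [|k _]; last first.
  rewrite TC2_FE; have := ltn_ord k => ki.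
  by rewrite !(gtn_eqF _) ?subrr ?mul0r // ?eqSS; lia.
by rewrite !TC2_FE IHi !eqxx (gtn_eqF (ltnSn i)) (ltn_eqF (ltnSn i.+1)) /=; lra.
Qed.

Lemma sum_leq_ord N j : \sum_(k < N) ((j <= k)%N)%:R = (N - j)%:R :> R.
Proof.
elim: N => [|N IHN]; first by rewrite big_ord0.
rewrite big_ord_recr /= IHN; case: leqP => jN; last by rewrite addr0; congr _%:R; lia.
by rewrite natr1 subSn.
Qed.

(** The entry counts the [k] with [j <= k <= i]; truncated subtraction makes it 0 above the
    diagonal. *)
Lemma TC2_Finv2E i j : TC2_Finv2 R i j = (i.+1 - j)%:R.
Proof.
rewrite /TC2_Finv2 TC2_FinvE (@inf_mul_finite _ _ i.+1) => [|k ik]; last first.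
  by rewrite {1}/inf_cumsum /inf_toeplitz leqNgt ik mul0r.
rewrite -sum_leq_ord; apply: eq_bigr => k _.
rewrite /inf_cumsum /inf_toeplitz -ltnS ltn_ord mul1r.
by case: leqP.
Qed.

Lemma TC2_Finv2_Dinv beta i k :
  inf_mul (inf_tr (TC2_Finv2 R)) (TC2_Dinv beta) i k
  = (k.+1 - i)%:R * beta ^+ k.+1.
Proof.
rewrite (@inf_mul_finite _ _ k.+1) => [|l kl]; last first.
  by rewrite /TC2_Dinv /inf_diag (gtn_eqF kl) mulr0.
rewrite big_ord_recr /= big1 => [|l _]; last first.
  by rewrite /TC2_Dinv /inf_diag (ltn_eqF (ltn_ord l)) mulr0.
by rewrite add0r /inf_tr TC2_Finv2E /TC2_Dinv /TC2_D /inf_diag eqxx invrK.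
Qed.

(** Only the last product is a genuine series; the others are finite sums. *)
Lemma TC2_kernel_series beta i j :
  TC2_kernel beta i j = (1 - beta) ^+ 3 *
    limn (series (fun k => (k.+1 - i)%:R * beta ^+ k.+1 * (k.+1 - j)%:R)).
Proof.
rewrite /TC2_kernel /inf_scale {1}/inf_mul; congr (_ * _); congr (limn (series _)).
by apply/funext => k; rewrite TC2_Finv2_Dinv TC2_Finv2E.
Qed.

Lemma TC2_kernelC beta i j : TC2_kernel beta i j = TC2_kernel beta j i.
Proof.
rewrite !TC2_kernel_series; congr (_ * _); congr (limn (series _)).
by apply/funext => k; ring.
Qed.

(* V k / (1 - beta)^3 is the closed form of the tail of the series from k on. *)
Lemma TC2_kernelE beta (i d : nat) : 0 < beta -> beta < 1 ->
  TC2_kernel beta i (i + d)%N =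
  beta ^+ (i + d).+1 * (1 + beta + d%:R * (1 - beta)).
Proof.
move=> b0 b1; pose j := (i + d)%N; rewrite -/j.
have c0 : (1 - beta) ^+ 3 != 0 by rewrite expf_neq0 // subr_eq0 gt_eqF.
pose V (k : nat) : R := let a := k.+1%:R - i%:R in let b := k.+1%:R - j%:R in
  beta ^+ k.+1 * (a * b * (1 - beta) ^+ 2 + (a + b) * beta * (1 - beta) +
                  beta * (1 + beta)).
pose u k : R := (k.+1 - i)%:R * beta ^+ k.+1 * (k.+1 - j)%:R.
(* Terms before [j] vanish by truncated subtraction; from [j] on,
   [(1 - beta)^3 * u k = V k - V k.+1]. *)
have Su m : (1 - beta) ^+ 3 * series u (j + m)%N = V j - V (j + m)%N.
  elim: m => [|m IHm].
    rewrite addn0 subrr /series /= big_nat_cond big1 ?mulr0 // => k.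
    rewrite andbT => /andP[_ kj]; rewrite /u.
    by rewrite (_ : k.+1 - j = 0)%N ?mulr0 //; lia.
  rewrite addnS /series /= big_nat_recr //= mulrDr -/(series u _) IHm.
  rewrite /u !natrB; [|rewrite /j; lia|rewrite /j; lia].
  rewrite /V !(exprS beta (j + m).+1) -!natr1; ring.
have V0 : (V n @[n --> \oo] --> (0 : R))%classic.
  have bn : (beta ^+ n @[n --> \oo] --> (0 : R))%classic.
    by apply: cvg_expr; rewrite ger0_norm // ltW.
  (* [V n] is [beta^n] times a quadratic in [n] with coefficients [A], [B], [C]. *)
  pose p : R := 1 - i%:R; pose q : R := 1 - j%:R.
  pose A : R := beta * (1 - beta) ^+ 2.
  pose B : R := beta * ((p + q) * (1 - beta) ^+ 2 + 2 * beta * (1 - beta)).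
  pose C : R := beta * (p * q * (1 - beta) ^+ 2 + (p + q) * beta * (1 - beta) +
                  beta * (1 + beta)).
  have -> : V = fun n => A * (n%:R ^+ 2 * beta ^+ n) + B * (n%:R * beta ^+ n)
                       + C * beta ^+ n.
    apply/funext => n; rewrite /V /A /B /C /p /q exprS -natr1; ring.
  rewrite -[0 in X in _ X](_ : A * 0 + B * 0 + C * 0 = 0); last first.
    by rewrite !mulr0 !addr0.
  apply: cvgD; first apply: cvgD; apply: cvgM; try exact: cvg_cst.
  - exact: cvg_natmul2_expr.
  - exact: cvg_natmul_expr.
  - exact: bn.
rewrite TC2_kernel_series -/u.
have -> : limn (series u) = (1 - beta) ^- 3 * (V j - 0).
  apply: cvg_lim => //.
  have H : ((1 - beta) ^- 3 * (V j - V n) @[n --> \oo] -->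
      (1 - beta) ^- 3 * (V j - 0))%classic.
    by apply: cvgM; [exact: cvg_cst | apply: cvgB; [exact: cvg_cst|]].
  apply: cvg_trans H; apply: near_eq_cvg.
  exists j => // n /= /subnKC <-.
  by rewrite -Su mulKf.
(* In [V j] the two factors are [a = d + 1] and [b = 1]. *)
by rewrite mulVKf // subr0 /V /j natrD -!natr1 natrD; ring.
Qed.

End Kernel.

(** * Cholesky factors of general matrices *)

(** Induction on columns: once the columns before [j] agree, [A i j] determines [L i j * L j j] for
    every [i]. The case [i = j] gives the pivot by positivity, and dividing by it gives the
    column. *)
Lemma cholesky_factor_unique (R : realType) n (A L M : 'M[R]_n) :
  is_cholesky_factor A L -> is_cholesky_factor A M -> L = M.
Proof.
move=> [/is_trig_mxP Ltr Lpos AL] [/is_trig_mxP Mtr Mpos AM].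
have LM i j : \sum_k L i k * L j k = \sum_k M i k * M j k.
  have : (L *m L^T) i j = (M *m M^T) i j by rewrite -AL AM.
  by rewrite !mxE; under eq_bigr do rewrite mxE; under [RHS]eq_bigr do rewrite mxE.
suff colLM k (j : 'I_n) : (j < k)%N -> forall i, L i j = M i j.
  by apply/matrixP => i j; apply: (colLM n).
elim: k j => // k IHk j jk.
have LMj i : L i j * L j j = M i j * M j j.
  have := LM i j; rewrite (bigD1 j) //= [RHS](bigD1 j) //=.
  rewrite (eq_bigr (fun k => M i k * M j k)) => [/addIr //|l lj].
  have [jl|] := ltnP j l; first by rewrite (Ltr j l) // (Mtr j l) // !mulr0.
  rewrite leq_eqVlt (inj_eq val_inj) (negbTE lj) /= => ltlj.
  by rewrite !IHk // (leq_trans ltlj).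
have LMjj : L j j = M j j.
  apply/eqP; rewrite -(eqrXn2 (n := 2)) ?(ltW (Lpos j)) ?(ltW (Mpos j)) //.
  by rewrite !expr2 LMj.
move=> i; have := LMj i; rewrite LMjj; apply: mulIf.
by rewrite gt_eqF.
Qed.

(* [L^T A L] is symmetric, and it is upper triangular since [A L] is. *)
Lemma trig_tr_mul_id (R : comPzRingType) n (A L : 'M[R]_n) :
  A^T = A -> is_trig_mx L -> is_trig_mx (A *m L)^T ->
  (forall i, L i i * (A *m L) i i = 1) -> L^T *m A *m L = 1%:M.
Proof.
move=> symA /is_trig_mxP Ltr /is_trig_mxP ALtr diag1; rewrite -mulmxA.
set U := A *m L in ALtr diag1 *.
have U0 (i j : 'I_n) : (j < i)%N -> U i j = 0 by move=> /ALtr; rewrite mxE.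
(* In the sum over [k], terms with [k < i] vanish by [Ltr] and those with [k > i] by [U0]. *)
have LU (i j : 'I_n) : (j <= i)%N -> (L^T *m U) i j = (i == j)%:R.
  move=> ji; rewrite mxE (bigD1 i) //= big1 ?addr0 => [|k ki]; rewrite mxE.
    case: eqP => [<-|/eqP ij]; first by rewrite diag1.
    by rewrite U0 ?mulr0 // ltn_neqAle ji andbT eq_sym.
  have [ik|ki'] := ltnP k i; first by rewrite Ltr ?mul0r.
  by rewrite U0 ?mulr0 // (leq_ltn_trans ji) // ltn_neqAle ki' eq_sym andbT.
have symLU : (L^T *m U)^T = L^T *m U by rewrite /U !trmx_mul trmxK symA mulmxA.
apply/matrixP => i j; rewrite [RHS]mxE.
have [/LU//|/ltnW/LU] := leqP j i.
by rewrite -[in LHS]symLU mxE eq_sym.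
Qed.

(** One-sided inverses of square matrices are two-sided, so the factors of [L^T A L = 1] rotate
    cyclically into [A (L L^T) = 1]. *)
Lemma cholesky_factor_inv (R : realType) n (A L : 'M[R]_n) :
  L^T *m A *m L = 1%:M -> is_trig_mx L -> (forall i, 0 < L i i) ->
  A \in unitmx /\ is_cholesky_factor (invmx A) L.
Proof.
move=> LAL Ltr Lpos.
have [_ uL] := mulmx1_unit LAL; have ALLT : A *m (L *m L^T) = 1%:M.
  by apply: mulmx1C; rewrite -mulmxA; apply: mulmx1C.
have [uA _] := mulmx1_unit ALLT; split=> //; split=> //.
by rewrite -[LHS]mulmx1 -ALLT mulKmx.
Qed.

(** * The explicit banded factor for [T = n + 2], and the determinant *)

Section CholeskyFactor.
Context {R : realType} (beta : R) (n : nat).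
Hypotheses (beta_gt0 : 0 < beta) (beta_lt1 : beta < 1).

Let a : R := beta ^- n.+1.
Let c j : R := (Num.sqrt ((1 - beta) ^+ 3 * beta ^+ j.+1))^-1.

(** The diagonals are indexed by column, from 0: columns [j < n] are regular, columns [n] and [n.+1]
    carry the boundary correction. *)
Definition chol_diag0 (j : nat) : R :=
  if (j < n)%N then c j
  else if j == n then Num.sqrt (a * (1 + beta)) / (1 - beta)
  else Num.sqrt (beta ^- n.+2 / (1 + beta)).

Definition chol_diag1 (j : nat) : R :=
  if (j < n)%N then - 2 * c j
  else if j == n then - 2 * Num.sqrt a / ((1 - beta) * Num.sqrt (1 + beta))
  else 0.

Definition chol_diag2 (j : nat) : R := if (j < n)%N then c j else 0.

Definition TC2_cholesky : 'M[R]_n.+2 := \matrix_(i, j)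
  (chol_diag0 j *+ (i == j :> nat) + chol_diag1 j *+ (i == j.+1 :> nat) +
   chol_diag2 j *+ (i == j.+2 :> nat)).

(** Since [K] is infinite, columns [j.+1] and [j.+2] may run past the finite matrix; their
    coefficients vanish there. *)
Lemma mul_TC2_cholesky (K : infmx R) (i j : 'I_n.+2) :
  ((\matrix_(i < n.+2, j < n.+2) K i j) *m TC2_cholesky) i j =
  K i j * chol_diag0 j + K i j.+1 * chol_diag1 j + K i j.+2 * chol_diag2 j.
Proof.
have sumE (b : R) m : (b != 0 -> (m < n.+2)%N) ->
    \sum_(k < n.+2) K i k * (b *+ (k == m :> nat)) = K i m * b.
  have [-> _|_ /(_ isT) mT] := eqVneq b 0.
    by rewrite mulr0 big1 // => k _; rewrite mul0rn mulr0.
  rewrite (bigD1 (Ordinal mT)) //= eqxx big1 ?addr0 // => k km.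
  rewrite (_ : k == m :> nat = false) ?mulr0 //.
  by apply: contra_neqF km => /eqP ?; apply: val_inj.
rewrite mxE (eq_bigr (fun k : 'I_n.+2 =>
    K i k * (chol_diag0 j *+ (k == j :> nat)) +
    K i k * (chol_diag1 j *+ (k == j.+1 :> nat)) +
    K i k * (chol_diag2 j *+ (k == j.+2 :> nat)))); last first.
  by move=> k _; rewrite !mxE !mulrDr.
rewrite !big_split /= !sumE //.
- rewrite /chol_diag2; case: ifP => [jn _|_]; [lia|by rewrite eqxx].
- rewrite /chol_diag1; case: ifP => [jn _|_]; first by lia.
  by case: (eqVneq (j : nat) n) => [->|_]; [lia | rewrite eqxx].
Qed.

Let omb_gt0 : 0 < 1 - beta. Proof. by rewrite subr_gt0. Qed.
Let opb_gt0 : 0 < 1 + beta. Proof. by rewrite addr_gt0. Qed.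
Let a_gt0 : 0 < a. Proof. by rewrite invr_gt0 exprn_gt0. Qed.

Let cV2 j : c j ^- 2 = (1 - beta) ^+ 3 * beta ^+ j.+1.
Proof.
by rewrite /c exprVn invrK sqr_sqrtr // mulr_ge0 ?exprn_ge0 // ltW.
Qed.

Let c_gt0 j : 0 < c j.
Proof. by rewrite invr_gt0 sqrtr_gt0 mulr_gt0 ?exprn_gt0. Qed.

Lemma chol_diag0_gt0 j : 0 < chol_diag0 j.
Proof.
rewrite /chol_diag0; do ![case: ifP => _] => //.
  by rewrite divr_gt0 // sqrtr_gt0 mulr_gt0.
by rewrite sqrtr_gt0 divr_gt0 // invr_gt0 exprn_gt0.
Qed.

Lemma TC2_cholesky_trig : is_trig_mx TC2_cholesky.
Proof.
apply/is_trig_mxP => i j ij; rewrite mxE.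
by rewrite !(ltn_eqF (_ : i < _)%N) ?addr0 //; lia.
Qed.

Lemma TC2_cholesky_diag i : TC2_cholesky i i = chol_diag0 i.
Proof. by rewrite mxE eqxx !(ltn_eqF (_ : i < _)%N) ?addr0 //; lia. Qed.

Lemma K_TC2_cholesky_lower (i j : 'I_n.+2) : (j < i)%N ->
  (K_TC2 beta n.+2 *m TC2_cholesky) i j = 0.
Proof.
move=> ji; have iT := ltn_ord i; rewrite mul_TC2_cholesky.
have Kij (k : nat) : (k <= i)%N -> TC2_kernel beta i k =
    beta ^+ i.+1 * (1 + beta + (i%:R - k%:R) * (1 - beta)).
  by move=> ki; rewrite TC2_kernelC -{1}(subnKC ki) TC2_kernelE // subnKC // natrB.
rewrite Kij ?(ltnW ji) // Kij //.
rewrite /chol_diag0 /chol_diag1 /chol_diag2; case: ltnP => jn.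
  have [ij|ij] := leqP j.+2 i; first by rewrite Kij // -!natr1; ring.
  (* Column [j.+2] is now one past the diagonal, where the kernel value [2 beta^(i+2)] still fits
     the affine formula. *)
  have -> : i = j.+1 :> nat by lia.
  have := @TC2_kernelE R beta j.+1 1 beta_gt0 beta_lt1.
  by rewrite addn1 => ->; rewrite (exprS _ j.+2) -!natr1; ring.
(* Only row [n.+1], column [n] remains: the last two entries of this row of [K] are proportional to
   [2, 1 + beta], the coefficients to [1 + beta, -2]. *)
have jn' : j = n :> nat by lia.
have -> : i = n.+1 :> nat by lia.
rewrite jn' eqxx mulr0 addr0 sqrtrM ?(ltW a_gt0) // -natr1.
have S0 : Num.sqrt (1 + beta) ^+ 2 = 1 + beta by rewrite sqr_sqrtr // ltW.
have s0 : Num.sqrt (1 + beta) != 0 by rewrite gt_eqF // sqrtr_gt0.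
move: S0 s0; set A := Num.sqrt a; set S := Num.sqrt (1 + beta) => S0 s0.
transitivity (2 * A * beta ^+ n.+2 / ((1 - beta) * S) * (S ^+ 2 - (1 + beta))).
  by field; rewrite s0 gt_eqF.
by rewrite S0 subrr mulr0.
Qed.

Lemma K_TC2_cholesky_diag (j : 'I_n.+2) :
  TC2_cholesky j j * (K_TC2 beta n.+2 *m TC2_cholesky) j j = 1.
Proof.
have jT := ltn_ord j; rewrite TC2_cholesky_diag mul_TC2_cholesky.
have b0 : beta != 0 by rewrite gt_eqF.
have opb0 : 1 + beta != 0 by rewrite gt_eqF.
have omb0 : 1 - beta != 0 by rewrite gt_eqF.
have KE := fun d => @TC2_kernelE R beta j d beta_gt0 beta_lt1.
have := KE 0%N; have := KE 1%N; have := KE 2%N.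
rewrite addn0 addn1 addn2 => -> -> ->.
rewrite /chol_diag0 /chol_diag1 /chol_diag2; case: ltnP => jn.
  (* The second difference [K j j - 2 K j (j+1) + K j (j+2)] equals [(1 - beta)^3 beta^(j+1)], which
     is [c j ^- 2]. *)
  have c0 : c j != 0 by rewrite gt_eqF.
  apply: (mulfI (_ : c j ^- 2 != 0)); first by rewrite invr_eq0 expf_neq0.
  rewrite mulr1 [RHS]cV2 (exprS _ j.+2) !(exprS _ j.+1).
  by field.
have [jn'|jn'] := eqVneq (j : nat) n.
  have A0 : Num.sqrt a ^+ 2 = beta ^- n.+1 by rewrite sqr_sqrtr // ltW.
  have S0 : Num.sqrt (1 + beta) ^+ 2 = 1 + beta by rewrite sqr_sqrtr // ltW.
  have s0 : Num.sqrt (1 + beta) != 0 by rewrite gt_eqF // sqrtr_gt0.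
  rewrite jn' sqrtrM ?(ltW a_gt0) // mulr0 addr0 (exprS _ n.+1).
  move: A0 S0 s0; set A := Num.sqrt a; set S := Num.sqrt (1 + beta) => A0 S0 s0.
  have B0 : beta ^+ n.+1 != 0 by rewrite expf_neq0.
  (* As [S^2 = 1 + beta], the last factor is [(1 + beta)^2 - 4 beta = (1 - beta)^2]. *)
  transitivity (A ^+ 2 * beta ^+ n.+1 / (1 - beta) ^+ 2 *
     (S ^+ 2 * (1 + beta) - 4 * beta)); first by field; rewrite s0 omb0.
  by rewrite A0 S0 mulVf //; field.
have -> : j = n.+1 :> nat by lia.
rewrite !mulr0 !addr0 mul0r addr0 mulrCA -expr2 sqr_sqrtr.
  by rewrite mulrCA mulrA; field; rewrite opb0 expf_neq0.
by rewrite divr_ge0 ?invr_ge0 ?exprn_ge0 // ltW.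
Qed.

Lemma K_TC2_sym : (K_TC2 beta n.+2)^T = K_TC2 beta n.+2.
Proof. by apply/matrixP => i j; rewrite !mxE TC2_kernelC. Qed.

Lemma TC2_cholesky_congr :
  TC2_cholesky^T *m K_TC2 beta n.+2 *m TC2_cholesky = 1%:M.
Proof.
apply: trig_tr_mul_id K_TC2_sym TC2_cholesky_trig _ K_TC2_cholesky_diag.
by apply/is_trig_mxP => i j ij; rewrite mxE K_TC2_cholesky_lower.
Qed.

Lemma det_K_TC2 : \det (K_TC2 beta n.+2) =
  beta ^+ ((n.+2 * (n.+2 + 1)) %/ 2) * (1 - beta) ^+ (3 * n.+2 - 4).
Proof.
have := congr1 determinant TC2_cholesky_congr.
rewrite det1 !det_mulmx det_tr (det_trig TC2_cholesky_trig).
have -> : \prod_i TC2_cholesky i i = \prod_(j < n.+2) chol_diag0 j.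
  by apply: eq_bigr => i _; rewrite TC2_cholesky_diag.
set p := \prod_(j < _) _ => detE.
have p0 : p != 0 by apply/prodf_neq0 => j _; rewrite gt_eqF // chol_diag0_gt0.
have -> : \det (K_TC2 beta n.+2) = p ^- 2.
  by apply: (mulfI p0); apply: (mulIf p0); rewrite detE; field.
(* Regular columns contribute [(1 - beta)^3 beta^(j+1)], the last two
   [(1 - beta)^2 beta^(n+1) / (1 + beta)] and [beta^(n+2) (1 + beta)]; the factors [1 + beta]
   cancel. *)
rewrite /p -exprVn -prodfV -prodrXl !big_ord_recr /=.
have -> : chol_diag0 n = Num.sqrt (a * (1 + beta)) / (1 - beta).
  by rewrite /chol_diag0 ltnn eqxx.
have -> : chol_diag0 n.+1 = Num.sqrt (beta ^- n.+2 / (1 + beta)).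
  by rewrite /chol_diag0 ltnNge leqnSn /= (gtn_eqF (ltnSn n)).
have -> : \prod_(i < n) (chol_diag0 i)^-1 ^+ 2 =
    (1 - beta) ^+ (3 * n) * \prod_(i < n) beta ^+ i.+1.
  rewrite exprM -[X in _ ^+ X]card_ord -prodr_const -big_split /=.
  by apply: eq_bigr => i _; rewrite /chol_diag0 ltn_ord exprVn cV2.
have -> : \prod_(i < n) beta ^+ i.+1 = beta ^+ ((n * n.+1) %/ 2).
  rewrite prodrXr; congr (_ ^+ _).
  elim: (n) => [|m IHm]; first by rewrite big_ord0.
  by rewrite big_ord_recr /= IHm; lia.
rewrite !exprVn expr_div_n !sqr_sqrtr; last 2 first.
- by rewrite divr_ge0 ?invr_ge0 ?exprn_ge0 // ltW.
- by rewrite mulr_ge0 // ltW.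
have -> : ((n.+2 * (n.+2 + 1)) %/ 2 = (n * n.+1) %/ 2 + n.+1 + n.+2)%N by lia.
have -> : (3 * n.+2 - 4 = 3 * n + 2)%N by lia.
rewrite !(exprD beta) (exprD (1 - beta)) /a.
have b0 k : beta ^+ k != 0 by rewrite expf_neq0 // gt_eqF.
by field; rewrite !b0 !gt_eqF.
Qed.

End CholeskyFactor.

(** * Entries of the Cholesky factor and the determinant *)

Theorem corollary6p1 (R : realType) (beta : R) (T : nat)
    (hbeta0 : 0 < beta) (hbeta1 : beta < 1) (hT : (2 <= T)%N) :
  [/\ K_TC2 beta T \in unitmx,
      exists L : 'M[R]_T, is_cholesky_factor (invmx (K_TC2 beta T)) L,
      forall L : 'M[R]_T, is_cholesky_factor (invmx (K_TC2 beta T)) L ->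
        forall i j : 'I_T,
        let t := (i.+1)%N in
        let s := (j.+1)%N in
        L i j =
          if [&& 1 <= t, t == s & t <= T - 2]%N then
            1 / Num.sqrt ((1 - beta) ^+ 3 * beta ^+ t)
          else if [&& 2 <= t, t == s + 1 & t <= T - 1]%N then
            - 2 / Num.sqrt ((1 - beta) ^+ 3 * beta ^+ (t - 1))
          else if [&& 3 <= t, t == s + 2 & t <= T]%N then
            1 / Num.sqrt ((1 - beta) ^+ 3 * beta ^+ (t - 2))
          else if [&& t == s & t == T - 1]%N then
            Num.sqrt (beta ^- (T - 1) * (1 + beta)) / (1 - beta)
          else if [&& t == s + 1 & t == T]%N then
            - 2 * Num.sqrt (beta ^- (T - 1)) / ((1 - beta) * Num.sqrt (1 + beta))
          else if [&& t == s & t == T]%N then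
            Num.sqrt (beta ^- T / (1 + beta))
          else 0
    & \det (K_TC2 beta T) =
        beta ^+ ((T * (T + 1)) %/ 2) * (1 - beta) ^+ (3 * T - 4)].
Proof.
case: T hT => [|[|n]] // _.
have [uK cholK] : K_TC2 beta n.+2 \in unitmx /\
    is_cholesky_factor (invmx (K_TC2 beta n.+2)) (TC2_cholesky beta n).
  apply: cholesky_factor_inv.
  - exact: TC2_cholesky_congr.
  - exact: TC2_cholesky_trig.
  - by move=> i; rewrite TC2_cholesky_diag chol_diag0_gt0.
split=> //; [by exists (TC2_cholesky beta n) | | exact: det_K_TC2].
move=> L cholL i j /=.
(* It remains to match the cases: with [t = i + 1], [s = j + 1], [T = n + 2], each of the three
   regular cases amounts to [j < n] on its band. *)
rewrite (cholesky_factor_unique _ _ _ _ _ cholL cholK) mxE.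
have iT := ltn_ord i; have jT := ltn_ord j.
rewrite /chol_diag0 /chol_diag1 /chol_diag2 !subSS !subn0 !addn1 !addn2 !eqSS !div1r.
have [ij|ij] := eqVneq (i : nat) j.
  rewrite ij (ltn_eqF (ltnSn j)) (ltn_eqF (leqnSn j.+1)) !addr0 mulr1n /= !andbF.
  case: ltnP => //= nj; case: eqVneq => // jn.
  by rewrite ifT //; lia.
have [ij1|ij1] := eqVneq (i : nat) j.+1.
  rewrite ij1 (ltn_eqF (ltnSn j.+1)) addr0 add0r mulr1n /= andbF ltnS eqSS.
  by case: ltnP.
have [ij2|ij2] := eqVneq (i : nat) j.+2; last by rewrite /= !andbF !addr0.
have jn : (j < n)%N by lia.
by rewrite ij2 !add0r mulr1n subn1 /= !ltnS jn.
Qed.
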